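(* Let $I$ be a set and let $\tau\colon\mathbb{R}^I\to\mathbb{R}$ be a function. The following are equivalent. (1) $\tau$ preserves measurability. (2) $\tau$ preserves measurability over $(\mathbb{R}^I,\mathrm{Cyl}(\mathbb{R}^I))$. (3) $\tau$ is $\mathrm{Cyl}(\mathbb{R}^I)$-measurable.
   Context: $\mathrm{Cyl}(\mathbb{R}^I)$ is the smallest $\sigma$-algebra on $\mathbb{R}^I$ making every projection $\pi_i\colon\mathbb{R}^I\to\mathbb{R}$ ($i\in I$) measurable; $\mathbb{R}$ carries its Borel $\sigma$-algebra. For a measurable space $(\Omega,\mathcal{F})$, $\tau$ preserves measurability over $(\Omega,\mathcal{F})$ if for every family $(f_i)_{i\in I}$ of $\mathcal{F}$-measurable functions $\Omega\to\mathbb{R}$, the function $\Omega\to\mathbb{R}$, $x\mapsto\tau((f_i(x))_{i\in I})$, is $\mathcal{F}$-measurable. $\tau$ preserves measurability if it preserves measurability over every measurable space. *)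

(* Defs.v *)
From HB Require Import structures.
From mathcomp Require Import all_boot all_order all_algebra.
From mathcomp Require Import all_classical all_reals all_analysis.
From mathcomp Require Import measurable_realfun.

Set Implicit Arguments.
Unset Strict Implicit.
Unset Printing Implicit Defensive.

Import numFieldNormedType.Exports.

Local Open Scope classical_set_scope.

(* The library defines [measurable] on [R] from half-open intervals. *)
Lemma measurable_Borel (R : realType) :
  (measurable : set (set R)) = <<s @open R >>.
Proof.
apply/seteqP; split; last first.
  apply: smallest_sub; first exact: sigma_algebra_measurable.
  by move=> A; exact: open_measurable.
rewrite [X in X `<=` _]RGenOpens.measurableE.
by apply: sub_sigma_algebra2 => _ [a [b ->]]; exact: interval_open.
Qed.

(* A measurable space is a type [Omega] with a set system [F] such that
   [sigma_algebra [set: Omega] F], rather than a [measurableType]: the latter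
   is pointed, which would leave out the empty measurable space. *)
Definition measurable_wrt (R : realType) (Omega : Type)
    (F : set (set Omega)) (f : Omega -> R) : Prop :=
  forall B : set R, measurable B -> F (f @^-1` B).

Lemma measurable_wrtE (R : realType) (d : measure_display)
    (T : measurableType d) (f : T -> R) :
  measurable_wrt measurable f <-> measurable_fun [set: T] f.
Proof.
split=> [mf _ B mB|mf B mB]; first by rewrite setTI; exact: mf.
by rewrite -[_ @^-1` _]setTI; exact: mf.
Qed.

Definition Cyl (R : realType) (I : Type) : set (set (I -> R)) :=
  <<s \bigcup_(i in [set: I])
        preimage_set_system [set: I -> R] (fun x => x i) measurable >>.

Lemma Cyl_smallest (R : realType) (I : Type) :
  [/\ sigma_algebra [set: I -> R] (@Cyl R I),
      (forall i : I, measurable_wrt (@Cyl R I) (fun x => x i)) &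
      forall F : set (set (I -> R)), sigma_algebra [set: I -> R] F ->
        (forall i : I, measurable_wrt F (fun x => x i)) -> @Cyl R I `<=` F].
Proof.
split; first exact: smallest_sigma_algebra.
- move=> i B mB; apply: sub_sigma_algebra; exists i => //.
  by exists B; rewrite ?setTI.
- move=> F sF mF; apply: smallest_sub => // _ [i _ [B mB <-]].
  by rewrite setTI; exact: mF.
Qed.

Definition preserves_measurability_over (R : realType) (I : Type)
    (Omega : Type) (F : set (set Omega)) (tau : (I -> R) -> R) : Prop :=
  forall f : I -> Omega -> R, (forall i, measurable_wrt F (f i)) ->
    measurable_wrt F (fun x => tau (fun i => f i x)).

Definition preserves_measurability (R : realType) (I : Type)
    (tau : (I -> R) -> R) : Prop :=
  forall (Omega : Type) (F : set (set Omega)), sigma_algebra [set: Omega] F ->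
    preserves_measurability_over F tau.

(* Main.v *)
(** By minimality of [Cyl], a map into [R^I] with measurable coordinates is
    measurable; [tau] applied to a family [f] is [tau] composed with such a map.
    Conversely, [tau] is itself its value on the family of all projections. *)
Require Import Defs.
From HB Require Import structures.
From mathcomp Require Import all_boot all_order all_algebra.
From mathcomp Require Import all_classical all_reals all_analysis.

Local Open Scope classical_set_scope.

(** Holds because preimages commute with complements and countable unions. *)
Lemma sigma_algebra_pushforward (T U : Type) (F : set (set T)) (g : T -> U) :
  sigma_algebra [set: T] F -> sigma_algebra [set: U] [set A | F (g @^-1` A)].
Proof.
case=> F0 FC FU; split=> /= [|A FA|A FA].
- by rewrite preimage_set0.
- by rewrite setTD -preimage_setC -setTD; exact: FC.
- by rewrite preimage_bigcup; exact: FU.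
Qed.

(** Minimality of [Cyl] is applied to the pushforward of [F] along the map with coordinates
    [f i]. *)
Lemma Cyl_preimage (R : realType) (I Omega : Type) (F : set (set Omega))
    (f : I -> Omega -> R) :
  sigma_algebra [set: Omega] F -> (forall i, measurable_wrt F (f i)) ->
  forall A, @Cyl R I A -> F ((fun x i => f i x) @^-1` A).
Proof.
move=> sF mf; have [_ _ Cyl_min] := Cyl_smallest R I.
apply: (Cyl_min [set A | F ((fun x i => f i x) @^-1` A)]).
- exact: sigma_algebra_pushforward.
(* The [i]-th projection after this map is [f i], by conversion. *)
- by move=> i B mB; exact: (mf i B mB).
Qed.

Theorem theorem3p3 (R : realType) (I : Type) (tau : (I -> R) -> R) :
  [<-> preserves_measurability tau;
       preserves_measurability_over (@Cyl R I) tau;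
       measurable_wrt (@Cyl R I) tau].
Proof.
have [sCyl mproj _] := Cyl_smallest R I.
tfae=> [ptau|ptau|mtau Omega F sF f mf B mB].
- exact: ptau.
- exact: (ptau (fun i x => x i) mproj).
- exact: (@Cyl_preimage _ _ _ _ f sF mf _ (mtau B mB)).
Qed.
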